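(* Let $\Omega,\mathcal{C}$ be closed, convex sets in $\mathbb{R}^d$ with nonempty interior, and $\mathcal{C}\subseteq\Omega$. Assume $f:\Omega\to\mathbb{R}$ is convex on $\mathcal{C}$, and differentiable on $\mathrm{int}(\Omega)$. Assume $\phi:\Omega\to\mathbb{R}$ is of Legendre type. Moreover, assume that $L\phi-f$ is convex on $\mathcal{C}\cap\mathrm{int}(\Omega)$, for some $L>0$. Consider the mirror descent (NoLips) iterates $$\theta_{t+1}=\arg\min_{\theta\in\mathcal{C}}\Big(\eta_t\langle\nabla f(\theta_t),\theta\rangle+D_\phi(\theta,\theta_t)\Big),$$ initialized at $\theta_0\in\mathcal{C}\cap\mathrm{int}(\Omega)$ with step sizes $\eta_t\in(0,1/L]$, $t=0,1,2,\dots$. For any reference point $z\in\mathcal{C}$, and any $T\ge1$, $$f(\theta_T)-f(z)\le\frac1{\sum_{t=0}^{T-1}\eta_t}\Big(D_\phi(z,\theta_0)-D_\phi(z,\theta_T)\Big).$$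
   Context: $\mathrm{int}(\Omega)$ is the interior of $\Omega$ (relative interior when $\Omega$ is not full-dimensional) and $\partial\Omega$ its boundary. The Bregman divergence of a convex $\phi$, differentiable on $\mathrm{int}(\Omega)$, is $D_\phi(u,v)=\phi(u)-\phi(v)-\langle\nabla\phi(v),u-v\rangle$, for $u\in\Omega$, $v\in\mathrm{int}(\Omega)$. Writing the mirror descent update presupposes that the minimizer exists. $\phi$ is of Legendre type if it is essentially smooth and essentially strictly convex. Essentially smooth: $\mathrm{int}(\Omega)\ne\emptyset$, $\phi$ is differentiable on $\mathrm{int}(\Omega)$, and $\|\nabla\phi(x_k)\|_2\to\infty$ for any sequence $\{x_k\}\subset\mathrm{int}(\Omega)$ converging to a point of $\partial\Omega$. Essentially strictly convex: strictly convex on every convex subset of $\{x\in\Omega:\partial\phi(x)\neq\emptyset\}$, where $\partial\phi(x)$ is the subdifferential. *)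

(* Defs.v *)
From HB Require Import structures.
From mathcomp Require Export all_boot all_order all_algebra.
From mathcomp Require Export all_classical all_reals interval_inference.
From mathcomp Require Export topology normedtype sequences derive convex.
Export Order.TTheory GRing.Theory Num.Theory.
Export numFieldNormedType.Exports.

Set Implicit Arguments.
Unset Strict Implicit.
Unset Printing Implicit Defensive.

Local Open Scope classical_set_scope.
Local Open Scope ring_scope.
Local Open Scope convex_scope.

(* R^d is 'rV[R]_d. The library norm on it is the sup norm, whose topology and
   differentiability are the Euclidean ones; the Euclidean norm is [enorm].
   A function Omega -> R is a total function on 'rV[R]_d: below its values
   outside Omega are never used, and derivatives are only taken in the
   interior of Omega, where they depend on the restriction to Omega alone. *)

Definition dotp (R : realType) (d : nat) (u v : 'rV[R]_d) : R :=
  \sum_(i < d) u 0 i * v 0 i.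

Definition enorm (R : realType) (d : nat) (u : 'rV[R]_d) : R :=
  Num.sqrt (dotp u u).

Definition grad (R : realType) (d : nat) (f : 'rV[R]_d -> R^o) (x : 'rV[R]_d) :
  'rV[R]_d := \row_(i < d) 'D_(delta_mx 0 i) f x.

Definition boundary (T : topologicalType) (A : set T) : set T :=
  closure A `\` A°.

Definition strictly_convex_function (R : realType) (E : lmodType R)
    (E' := convex_lmodType E) (D : set E') (f : E' -> R^o) :=
  forall t : {i01 R}, 0 < t%:num -> t%:num < 1 ->
    {in D &, forall x y : E', x != y -> f (x <| t |> y) < f x <| t |> f y}.

(* phi is understood to be +oo outside Omega. *)
Definition subdifferential (R : realType) (d : nat) (Omega : set 'rV[R]_d)
    (phi : 'rV[R]_d -> R^o) (x : 'rV[R]_d) : set 'rV[R]_d :=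
  [set g | forall y, Omega y -> phi x + dotp g (y - x) <= phi y].

Definition essentially_smooth (R : realType) (d : nat) (Omega : set 'rV[R]_d)
    (phi : 'rV[R]_d -> R^o) : Prop :=
  [/\ Omega° !=set0,
      forall x, Omega° x -> differentiable phi x
    & forall (u : nat -> 'rV[R]_d) (x : 'rV[R]_d),
        (forall k, Omega° (u k)) -> boundary Omega x ->
        u k @[k --> \oo] --> x ->
        enorm (grad phi (u k)) @[k --> \oo] --> +oo].

Definition essentially_strictly_convex (R : realType) (d : nat)
    (Omega : set 'rV[R]_d) (phi : 'rV[R]_d -> R^o) : Prop :=
  forall S : set 'rV[R]_d,
    S `<=` [set x | Omega x /\ subdifferential Omega phi x !=set0] ->
    convex_set S -> strictly_convex_function S phi.

Definition legendre_type (R : realType) (d : nat) (Omega : set 'rV[R]_d)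
    (phi : 'rV[R]_d -> R^o) : Prop :=
  essentially_smooth Omega phi /\ essentially_strictly_convex Omega phi.

(* Meaningful for u in Omega and v in the interior of Omega. *)
Definition bregman (R : realType) (d : nat) (phi : 'rV[R]_d -> R^o)
    (u v : 'rV[R]_d) : R :=
  phi u - phi v - dotp (grad phi v) (u - v).

Definition argmin (R : realType) (T : Type) (A : set T) (g : T -> R) : set T :=
  [set x | A x /\ forall y, A y -> g x <= g y].

Definition mirror_descent (R : realType) (d : nat) (C : set 'rV[R]_d)
    (f phi : 'rV[R]_d -> R^o) (eta : nat -> R) (theta : nat -> 'rV[R]_d) :
  Prop :=
  forall t : nat,
    argmin C (fun x => eta t * dotp (grad f (theta t)) x
                       + bregman phi x (theta t)) (theta t.+1).

(* Main.v *)
From mathcomp Require Import ring lra.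
Require Import Defs.

(** The proof has two halves: the iterates never leave the interior of Omega,
    and then every step makes a definite progress towards every reference point.

    Interior.  Suppose that a minimizer x over C of phi plus a linear form lies
    on the boundary of Omega, and pull it towards an interior point w of C along
    the points u = x + s (w - x), which are interior to Omega for 0 < s <= 1.
    Minimality of x and convexity bound the slope of phi at u in the direction
    w - x from below, while phi is bounded above on a whole ball around w.  The
    affine minorant of phi at u, evaluated on that ball, therefore bounds grad
    phi u uniformly in s ([segment_grad_bounded]).  Letting s tend to 0 contradicts
    essential smoothness ([argmin_interior]).

    Progress.  Let y be the iterate after x.  First-order optimality of y and the
    three-point identity give, for every z in C,
      eta <grad f x, y - z> <= D(z, x) - D(z, y) - D(y, x).
    Convexity of L phi - f gives the descent inequality
      f y <= f x + <grad f x, y - x> + L D(y, x),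
    and convexity of f gives f z >= f x + <grad f x, z - x>.  Since eta L <= 1,
    they combine into eta (f y - f z) <= D(z, x) - D(z, y)
    ([mirror_step_progress]).  For z = x this says that f decreases along the
    iterates, so that summing over the steps, where the right-hand sides
    telescope, allows every f(theta_(t+1)) to be replaced by f(theta_T). *)

Set Implicit Arguments.
Unset Strict Implicit.
Unset Printing Implicit Defensive.

Local Open Scope classical_set_scope.
Local Open Scope ring_scope.

(** * The dot product and its two norms *)

Section Dotp.
Context {R : realType} {d : nat}.
Implicit Types (u v w : 'rV[R]_d) (a : R).

Lemma dotpDr u v w : dotp u (v + w) = dotp u v + dotp u w.
Proof. by rewrite -big_split; apply: eq_bigr => i _; rewrite mxE mulrDr. Qed.

Lemma dotpDl u v w : dotp (v + w) u = dotp v u + dotp w u.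
Proof. by rewrite -big_split; apply: eq_bigr => i _; rewrite mxE mulrDl. Qed.

Lemma dotpZr a u v : dotp u (a *: v) = a * dotp u v.
Proof. by rewrite mulr_sumr; apply: eq_bigr => i _; rewrite mxE; ring. Qed.

Lemma dotpZl a u v : dotp (a *: u) v = a * dotp u v.
Proof. by rewrite mulr_sumr; apply: eq_bigr => i _; rewrite mxE; ring. Qed.

Lemma dotpBr u v w : dotp u (v - w) = dotp u v - dotp u w.
Proof. by rewrite dotpDr -scaleN1r dotpZr mulN1r. Qed.

Lemma dotpBl u v w : dotp (v - w) u = dotp v u - dotp w u.
Proof. by rewrite dotpDl -scaleN1r dotpZl mulN1r. Qed.

Lemma dotpp_ge0 u : 0 <= dotp u u.
Proof. by apply: sumr_ge0 => i _; rewrite -expr2 sqr_ge0. Qed.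

Lemma enorm_ge0 u : 0 <= enorm u. Proof. exact: sqrtr_ge0. Qed.

Lemma sqr_enorm u : enorm u ^+ 2 = dotp u u.
Proof. exact/sqr_sqrtr/dotpp_ge0. Qed.

Lemma norm_le_enorm u : `|u| <= enorm u.
Proof.
rewrite /Num.norm /= mx_normrE; apply: bigmax_le => [|[i j] _ /=].
  exact: enorm_ge0.
rewrite (ord1 i) -sqrtr_sqr ler_sqrt ?dotpp_ge0//.
rewrite /dotp (bigD1 j)//= -expr2 lerDl.
by apply: sumr_ge0 => k _; rewrite -expr2 sqr_ge0.
Qed.

(** The linear form g attains its Euclidean norm in the direction of g itself;
    as the sup norm is at most the Euclidean norm, the rescaled vector stays in
    the sup-norm ball of radius r. *)
Lemma enorm_le_dual (g : 'rV[R]_d) (r K : R) : 0 <= K ->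
  (forall e : 'rV[R]_d, `|e| <= r -> dotp g e <= K) -> 0 < r -> r * enorm g <= K.
Proof.
move=> K0 gK r0; have [g0|gn0] := eqVneq (enorm g) 0; first by rewrite g0 mulr0.
have gp : 0 < enorm g by rewrite lt_neqAle eq_sym gn0 enorm_ge0.
have -> : r * enorm g = dotp g ((r / enorm g) *: g).
  by rewrite dotpZr -sqr_enorm; field.
have a0 : 0 <= r / enorm g by rewrite divr_ge0 ?ltW.
apply: gK; rewrite normrZ (ger0_norm a0).
have : r / enorm g * `|g| <= r / enorm g * enorm g.
  by apply: ler_wpM2l (norm_le_enorm g).
by rewrite divfK.
Qed.

End Dotp.

(** * Directional derivatives *)

Section Derivatives.
Context {R : realType} {d : nat}.
Implicit Types (f : 'rV[R]_d -> R^o) (x v : 'rV[R]_d).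

Lemma derive_dotp_grad f x v :
  differentiable f x -> 'D_v f x = dotp (grad f x) v.
Proof.
move=> fx; rewrite deriveE// [in LHS](row_sum_delta v) linear_sum.
by apply: eq_bigr => i _; rewrite linearZ/= mxE deriveE// mulrC.
Qed.

(** Only the increments along the open segment from x to x + v are controlled,
    because x may lie on the boundary of the set where f is known to be convex or
    minimal; the derivative is then read off the one-sided limit. *)
Lemma ge_derive f x v (b : R) : differentiable f x ->
  (forall h : R, 0 < h < 1 -> h * b <= f (x + h *: v) - f x) ->
  b <= dotp (grad f x) v.
Proof.
move=> fx fb; rewrite -derive_dotp_grad// /derive.
have /cvg_dnbhs_at_right q_cvg := @diff_derivable _ _ _ _ _ v fx.
rewrite -(cvg_lim _ q_cvg)//.
apply: limr_ge; first by apply/cvg_ex; eexists; exact: q_cvg.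
near=> h.
rewrite /= -[_ *: _]/(h^-1 * _) ler_pdivlMl; last by near: h; exact: nbhs_right_gt.
rewrite [X in f X]addrC; apply: fb; apply/andP; split.
  by near: h; exact: nbhs_right_gt.
by near: h; exact: nbhs_right_lt.
Unshelve. all: by end_near. Qed.

Lemma derive_le f x v (b : R) : differentiable f x ->
  (forall h : R, 0 < h < 1 -> f (x + h *: v) - f x <= h * b) ->
  dotp (grad f x) v <= b.
Proof.
move=> fx fb; rewrite -lerN2 -derive_dotp_grad//.
rewrite -deriveN; last exact: diff_derivable.
rewrite derive_dotp_grad; last exact: differentiableN.
apply: ge_derive; first exact: differentiableN.
move=> h /fb; rewrite -lerN2 mulrN opprB /= !fctE; lra.
Qed.

End Derivatives.

(** * Convex functions and minimizers *)

Section Convexity.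
Local Open Scope convex_scope.
Context {R : realType} {d : nat}.
Implicit Types (A C Omega : set 'rV[R]_d) (f phi : 'rV[R]_d -> R^o).
Implicit Types (x y c : 'rV[R]_d).

Lemma conv_segment (x y : convex_lmodType 'rV[R]_d) (t : {i01 R}) :
  y <| t |> x = (x + t%:num *: (y - x) :> 'rV[R]_d).
Proof.
rewrite -[LHS]/(t%:num *: (y : 'rV[R]_d) + (1 - t%:num) *: (x : 'rV[R]_d)).
by apply/rowP => i; rewrite !mxE; ring.
Qed.

Lemma convR_segment (a b : R^o) (t : {i01 R}) :
  b <| t |> a = (a + t%:num * (b - a) :> R).
Proof. by rewrite -[LHS]/(t%:num * b + (1 - t%:num) * a); ring. Qed.

Lemma convex_set_segment A x y (h : R) : convex_set A ->
  A x -> A y -> 0 <= h <= 1 -> A (x + h *: (y - x)).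
Proof.
move=> cA Ax Ay /andP[h0 h1].
have := cA y x (Itv01 h0 h1) (mem_set Ay) (mem_set Ax).
by rewrite conv_segment => /set_mem.
Qed.

Lemma convex_function_segment A f x y (h : R) : convex_function A f ->
  A x -> A y -> 0 <= h <= 1 -> f (x + h *: (y - x)) <= f x + h * (f y - f x).
Proof.
move=> cf Ax Ay /andP[h0 h1].
have := cf (Itv01 h0 h1) y x (mem_set Ay) (mem_set Ax).
by rewrite conv_segment convR_segment.
Qed.

Lemma convex_function_grad A f x y : convex_function A f ->
  A x -> A y -> differentiable f x -> f x + dotp (grad f x) (y - x) <= f y.
Proof.
move=> cf Ax Ay fx; rewrite -lerBrDl; apply: derive_le => // h /andP[h0 h1].
have h01 : 0 <= h <= 1 by rewrite !ltW.
have := convex_function_segment cf Ax Ay h01; lra.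
Qed.

(** Minimality of x bounds the increments of phi along the segment from x to y
    from below by the linear form - c, hence its slope at x. *)
Lemma first_order_optimality C phi x y c : convex_set C -> differentiable phi x ->
  argmin C (fun u => dotp c u + phi u) x -> C y ->
  0 <= dotp (c + grad phi x) (y - x).
Proof.
move=> cC phix [Cx xmin] Cy; rewrite dotpDl.
suff : - dotp c (y - x) <= dotp (grad phi x) (y - x) by lra.
apply: ge_derive => // h /andP[h0 h1].
have := xmin (x + h *: (y - x)).
rewrite dotpDr dotpZr => le_h.
suff : C (x + h *: (y - x)) by move=> /le_h; lra.
by apply: convex_set_segment => //; rewrite !ltW.
Qed.

(** The homothety of centre x and ratio s maps a neighbourhood of w contained in
    Omega onto a neighbourhood of x + s (w - x), still contained in Omega. *)
Lemma interior_segment Omega x w (s : R) : convex_set Omega ->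
  Omega x -> Omega° w -> 0 < s <= 1 -> Omega° (x + s *: (w - x)).
Proof.
move=> cO Ox Ow /andP[s0 s1]; rewrite /interior /=.
(* the inverse homothety *)
pose g (y : 'rV[R]_d) : 'rV[R]_d := x + s^-1 *: (y - x).
have gw : g (x + s *: (w - x)) = w.
  by rewrite /g [x + s *: _]addrC addrK scalerA mulVf ?gt_eqF// scale1r subrKC.
have g_cont : {for (x + s *: (w - x)), continuous g}.
  apply: continuousD; first exact: cst_continuous.
  apply: continuousZr; apply: continuousB; last exact: cst_continuous.
  exact: cvg_id.
have : nbhs (x + s *: (w - x)) (g @^-1` Omega) by apply: g_cont; rewrite gw.
apply: filterS => y Oy.
have -> : y = x + s *: (g y - x).
  by rewrite /g [x + s^-1 *: _]addrC addrK scalerA divff ?gt_eqF// scale1r subrKC.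
by apply: convex_set_segment => //; rewrite (ltW s0).
Qed.

(** With u = x + s (w - x), minimality of x gives <grad phi u, w - x> >=
    - <c, w - x>.  Inserting this in the affine minorant of phi at u, evaluated at
    the points w + e of a ball around w where phi is bounded above, bounds
    <grad phi u, e>, independently of s. *)
Lemma segment_grad_bounded Omega C phi c x w : convex_set Omega ->
  convex_function Omega phi ->
  (forall u, Omega° u -> differentiable phi u) ->
  C `<=` Omega -> convex_set C ->
  argmin C (fun u => dotp c u + phi u) x -> C° w ->
  exists K : R, forall s : R, 0 < s <= 1 ->
    enorm (grad phi (x + s *: (w - x))) <= K.
Proof.
move=> cO cphi dphi CO cC [Cx xmin] Cw.
have Ow : Omega° w by exact: interiorS Cw.
have Ox := CO _ Cx.
have Owi := interior_subset Ow.
pose v := w - x; pose M := dotp (grad phi w + c) v.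
have [r r0 rP] : exists2 r : R, 0 < r & forall e : 'rV[R]_d, `|e| <= r ->
    Omega (w + e) /\ phi (w + e) <= phi w + 1.
  have phi_le : \forall y \near w, phi y <= phi w + 1.
    have phi_cont := differentiable_continuous (dphi _ Ow).
    by apply: (cvgr_le (phi w) phi_cont); rewrite ltrDl.
  have /nbhs_ballP[e /= e0 eP] :
      nbhs w (Omega `&` [set y | phi y <= phi w + 1]) by exact: filterI.
  exists (e / 2); first by rewrite divr_gt0.
  move=> u ur; apply: eP; rewrite -ball_normE /= opprD addNKr normrN.
  by apply: le_lt_trans ur _; rewrite ltr_pdivrMr// ltr_pMr// ltr1n.
(* 1 is the slack in the bound of phi on the ball; M comes from comparing phi u
   with phi w and from the slope at u. *)
exists ((1 + `|M|) / r) => s s01.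
have [s0 s1] := andP s01.
rewrite -/v; set u := x + s *: v; set G := grad phi u.
have Ou : Omega° u by exact: interior_segment.
have uE : u = x + s *: v by [].
have Oui := interior_subset Ou.
have Cu : C u.
  by apply: convex_set_segment (interior_subset Cw) _ => //; rewrite (ltW s0).
have phiu_ge := convex_function_grad cphi Owi Oui (dphi _ Ow).
have G_x := convex_function_grad cphi Oui Ox (dphi _ Ou).
have min_u := xmin _ Cu.
rewrite ler_pdivlMr// mulrC; apply: enorm_le_dual => // e er.
have [Owe phi_we] := rP _ er.
have := convex_function_grad cphi Oui Owe (dphi _ Ou).
rewrite -/G in G_x *.
move: phiu_ge G_x min_u.
have -> : x - u = - s *: v by apply/rowP => i; rewrite !mxE; ring.
have -> : u - w = - (1 - s) *: v by apply/rowP => i; rewrite !mxE; ring.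
have -> : w + e - u = e + (1 - s) *: v.
  by apply/rowP => i; rewrite !mxE; ring.
clearbody v; rewrite [in dotp c u]uE !(dotpDr, dotpZr) => phiu_ge G_x min_u we.
have := ler_norm M; rewrite {1}/M dotpDl.
have := normr_ge0 M; move: (`|M|) => m m0.
set a := dotp (grad phi w) _ in phiu_ge *.
set b := dotp c v in min_u *; set g := dotp G v in we G_x *.
move=> ab.
(* the slope of phi at u towards w cannot be too negative, by minimality of x *)
have gb : - b <= g by rewrite -(ler_pM2l s0); lra.
have : (1 - s) * (a + b) <= m by nra.
have : 0 <= (1 - s) * (g + b) by apply: mulr_ge0; lra.
lra.
Qed.

(** The barrier effect of an essentially smooth function: the gradients stay
    bounded along a segment that ends at the minimizer x, so that x is not a
    boundary point. *)
Lemma argmin_interior Omega C phi c x : convex_set Omega ->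
  convex_function Omega phi -> essentially_smooth Omega phi ->
  C `<=` Omega -> convex_set C -> C° !=set0 ->
  argmin C (fun u => dotp c u + phi u) x -> Omega° x.
Proof.
move=> cO cphi [_ dphi blowup] CO cC [w Cw] xmin.
have Ox : Omega x by apply: CO; case: xmin.
apply: contrapT => nOx.
have [K KP] := segment_grad_bounded cO cphi dphi CO cC xmin Cw.
pose u k := x + k.+1%:R^-1 *: (w - x).
have s01 k : 0 < (k.+1%:R^-1 : R) <= 1.
  by rewrite invr_gt0 ltr0n invf_le1 ?ltr0n// ler1n.
have Ou k : Omega° (u k).
  by apply: interior_segment => //; exact: interiorS Cw.
have ux : u k @[k --> \oo] --> x.
  suff : u k @[k --> \oo] --> x + 0 *: (w - x) by rewrite scale0r addr0.
  apply: cvgD; first exact: cvg_cst.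
  by apply: cvgZr_tmp; exact: cvg_harmonic.
have bx : boundary Omega x by split; first exact: subset_closure.
have /cvgryPge/(_ (K + 1)) [N _ /(_ N (leqnn N))] /= := blowup u x Ou bx ux.
by have := KP _ (s01 N); rewrite -/(u N); lra.
Qed.

End Convexity.

(** * One mirror descent step *)

Section MirrorStep.
Context {R : realType} {d : nat}.
Implicit Types (C Omega : set 'rV[R]_d) (f phi : 'rV[R]_d -> R^o).

Lemma bregman_three_points phi (x y z : 'rV[R]_d) :
  bregman phi z x - bregman phi z y - bregman phi y x =
  dotp (grad phi y - grad phi x) (z - y).
Proof. by rewrite /bregman dotpBl !dotpBr; ring. Qed.

Lemma bregmanxx phi (x : 'rV[R]_d) : bregman phi x x = 0.
Proof. by rewrite /bregman dotpBr !subrr. Qed.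

Lemma bregman_ge0 A phi (x y : 'rV[R]_d) : convex_function A phi ->
  A x -> A y -> differentiable phi x -> 0 <= bregman phi y x.
Proof.
move=> cphi Ax Ay phix; have := convex_function_grad cphi Ax Ay phix.
rewrite /bregman; lra.
Qed.

(** This is the tangent inequality of L phi - f at x, with the gradient split by
    linearity. *)
Lemma relative_descent A f phi (L : R) (x y : 'rV[R]_d) :
  convex_function A (fun u => L * phi u - f u) -> A x -> A y ->
  differentiable f x -> differentiable phi x ->
  f y <= f x + dotp (grad f x) (y - x) + L * bregman phi y x.
Proof.
move=> cLf Ax Ay fx phix.
have Lphix : differentiable (L \*: phi) x by exact: differentiableZ.
have Lfx : differentiable (L \*: phi - f) x by exact: differentiableB.
have := convex_function_grad cLf Ax Ay Lfx.
rewrite -derive_dotp_grad// deriveB; [|exact: diff_derivable..].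
rewrite deriveZ; last exact: diff_derivable.
rewrite !derive_dotp_grad// /bregman -[_ *: _]/(L * _); lra.
Qed.

(** The two objectives differ by a constant; the second one has the form of a
    linear perturbation of phi. *)
Lemma mirror_step_argmin C f phi (eta : R) (x y : 'rV[R]_d) :
  argmin C (fun u => eta * dotp (grad f x) u + bregman phi u x) y ->
  argmin C (fun u => dotp (eta *: grad f x - grad phi x) u + phi u) y.
Proof.
move=> [Cy ymin]; split=> // u /ymin.
rewrite /bregman !(dotpBl, dotpZl, dotpBr); lra.
Qed.

(** Adding the optimality of y, the relative descent inequality and the tangent
    inequality of f at x leaves the term (eta L - 1) D(y, x), which is
    nonpositive. *)
Lemma mirror_step_progress Omega C f phi (L eta : R) (x y z : 'rV[R]_d) :
  convex_set C -> C `<=` Omega ->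
  convex_function C f -> convex_function Omega phi ->
  convex_function (C `&` Omega°) (fun u => L * phi u - f u) ->
  0 < L -> 0 < eta <= 1 / L ->
  C x -> Omega° x -> Omega° y -> C z ->
  differentiable f x -> differentiable phi x -> differentiable phi y ->
  argmin C (fun u => eta * dotp (grad f x) u + bregman phi u x) y ->
  eta * (f y - f z) <= bregman phi z x - bregman phi z y.
Proof.
move=> cC CO cf cphi cLf L0 /andP[eta0 etaL] Cx Ox Oy Cz fx phix phiy ymin.
have Cy : C y by case: ymin.
have := first_order_optimality cC phiy (mirror_step_argmin ymin) Cz.
(* the gradients are regrouped as eta grad f x + (grad phi y - grad phi x) *)
rewrite -addrA [_ + grad phi y]addrC dotpDl -bregman_three_points dotpZl => opt.
have descent := relative_descent cLf (conj Cx Ox) (conj Cy Oy) fx phix.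
have f_tangent := convex_function_grad cf Cx Cz fx.
have D_ge0 := bregman_ge0 cphi (CO _ Cx) (CO _ Cy) phix.
have etaL1 : eta * L <= 1 by move: etaL; rewrite ler_pdivlMr.
have fyz : eta * (f y - f z) <=
    eta * (dotp (grad f x) (y - z) + L * bregman phi y x).
  rewrite ler_pM2l//; move: descent f_tangent; rewrite !dotpBr; lra.
have : eta * L * bregman phi y x <= bregman phi y x by rewrite ler_piMl.
move: opt fyz; rewrite !dotpBr; lra.
Qed.

End MirrorStep.

Theorem theorem8 (R : realType) (d : nat) (Omega C : set 'rV[R]_d)
    (f phi : 'rV[R]_d -> R^o) (L : R)
    (eta : nat -> R) (theta : nat -> 'rV[R]_d)
    (Omega_closed : closed Omega) (Omega_convex : convex_set Omega)
    (Omega_int : Omega° !=set0)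
    (C_closed : closed C) (C_convex : convex_set C) (C_int : C° !=set0)
    (C_sub : C `<=` Omega)
    (f_convex : convex_function C f)
    (f_diff : forall x, Omega° x -> differentiable f x)
    (phi_convex : convex_function Omega phi)
    (phi_legendre : legendre_type Omega phi)
    (L_gt0 : 0 < L)
    (Lphi_f_convex : convex_function (C `&` Omega°) (fun x => L * phi x - f x))
    (theta0 : (C `&` Omega°) (theta 0%N))
    (eta_range : forall t, 0 < eta t <= 1 / L)
    (theta_md : mirror_descent C f phi eta theta)
    (z : 'rV[R]_d) (Cz : C z) (T : nat) (T_ge1 : (1 <= T)%N) :
  f (theta T) - f z <=
    1 / (\sum_(0 <= t < T) eta t) *
    (bregman phi z (theta 0%N) - bregman phi z (theta T)).
Proof.
case: phi_legendre => [smooth _].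
have phi_diff : forall x, Omega° x -> differentiable phi x by case: smooth.
have theta_in t : C (theta t) /\ Omega° (theta t).
  elim: t => [|t [_ _]]; first exact: theta0.
  have theta_min := mirror_step_argmin (theta_md t).
  split; first by case: theta_min.
  exact: argmin_interior phi_convex smooth _ C_convex C_int theta_min.
have step t u : C u -> eta t * (f (theta t.+1) - f u) <=
    bregman phi u (theta t) - bregman phi u (theta t.+1).
  move=> Cu; have [Ct Ot] := theta_in t; have [_ Ot1] := theta_in t.+1.
  by apply: mirror_step_progress Lphi_f_convex _ _ _ _ _ _ _ _ _ _ => //; auto.
have eta_gt0 t : 0 < eta t by case/andP: (eta_range t).
have f_mono t : f (theta t.+1) <= f (theta t).
  have [Ct Ot] := theta_in t; have [Ct1 Ot1] := theta_in t.+1.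
  (* the progress inequality with the current iterate as reference point *)
  rewrite -subr_le0 -(pmulr_rle0 _ (eta_gt0 t)).
  apply: le_trans (step _ _ Ct) _.
  have := bregman_ge0 phi_convex (C_sub _ Ct1) (C_sub _ Ct) (phi_diff _ Ot1).
  by rewrite bregmanxx; lra.
have sum_le n : (\sum_(0 <= t < n) eta t) * (f (theta n) - f z) <=
    bregman phi z (theta 0%N) - bregman phi z (theta n).
  elim: n => [|n IHn]; first by rewrite big_geq// mul0r subrr.
  rewrite big_nat_recr//= mulrDl.
  have S_ge0 : 0 <= \sum_(0 <= t < n) eta t by apply: sumr_ge0 => t _; exact: ltW.
  have := ler_wpM2l S_ge0 (lerB (f_mono n) (lexx (f z))).
  have := step n z Cz; lra.
have S_gt0 : 0 < \sum_(0 <= t < T) eta t.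
  case: T T_ge1 => // n _; rewrite big_nat_recr//= ltr_wpDl//.
  by apply: sumr_ge0 => t _; exact: ltW.
by rewrite div1r mulrC ler_pdivlMr// mulrC; exact: sum_le.
Qed.
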